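(* Every realization $\langle W,V,Z\rangle$ of the Lie algebra $\mathrm{sl}(2,\mathbb{R})$ by vector fields on the circle $S^1$ (with vector fields from the class $\mathcal{C}$) has, up to equivalence transformations, one of the following forms: $$\langle W,V,Z\rangle=\left\langle \sigma_k(\theta)\,(1-\cos(n\theta))\frac{d}{d\theta},\ \frac1n\sin(n\theta)\frac{d}{d\theta},\ \frac{1}{n^2}\,\sigma_k(\theta)\,(1+\cos(n\theta))\frac{d}{d\theta}\right\rangle$$ for some integer $n\ge1$, where, for each $k=0,1,\dots,n-1$, $\sigma_k(\theta)=\pm1$ is constant on the interval $\left(\frac{2\pi k}{n},\frac{2\pi(k+1)}{n}\right)$.
   Context: The circle $S^1$ is parametrized by $\theta\in[0,2\pi)$. A vector field on $S^1$ is $v(\theta)\frac{d}{d\theta}$ with $v$ a real $2\pi$-periodic function; vector fields are of class $C^1$ (i.e. $v$ is continuously differentiable). The commutator is $\left[v\frac{d}{d\theta},w\frac{d}{d\theta}\right]=(vw'-v'w)\frac{d}{d\theta}$. A singular point of $v\frac{d}{d\theta}$ is a zero of $v$. The class $\mathcal{C}$ consists of the $C^1$ vector fields on $S^1$ whose set of singular points contains no nonempty open interval. A realization of $\mathrm{sl}(2,\mathbb{R})$ is a three-dimensional Lie algebra of vector fields $\langle W,V,Z\rangle$ with nonzero elements in $\mathcal{C}$, whose generators $W=w(\theta)\frac{d}{d\theta}$, $V=v(\theta)\frac{d}{d\theta}$, $Z=z(\theta)\frac{d}{d\theta}$ satisfy $[V,W]=W$, $[Z,V]=Z$, $[W,Z]=-2V$.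 An equivalence transformation is a map $f:S^1\to S^1$ such that: (i) $f$ is a one-to-one mapping of the circle onto itself; (ii) $f$ is continuous at every point; (iii) $f$ is continuously differentiable at all points except a finite number of them; (iv) $f'(\theta)$ tends to $-\infty$ or $+\infty$ at all points of discontinuity of $f'$; (v) under the change of coordinate $\tilde\theta=f(\theta)$ the $C^1$ vector fields to which the transformation is applied are transformed into vector fields of class $C^1$. Here $w(\theta)\frac{d}{d\theta}$ is transformed into $\tilde w(\tilde\theta)\frac{d}{d\tilde\theta}$ with $\tilde w(f(\theta))=w(\theta)f'(\theta)$ (at the finitely many exceptional points $\tilde w$ is determined by continuity). Rotations of the circle are included among these transformations. Two realizations are equivalent if one can be transformed to the other by a composition of equivalence transformations. *)

(* Defs.v *)
(* Stdlib reals with Coquelicot. *)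
From Stdlib Require Import Reals ZArith List Relations.
From Coquelicot Require Import Coquelicot.
Open Scope R_scope.

(** The circle is R/2πZ: an angle is a real number, and two angles are the same
    point of the circle when they are congruent modulo 2π. *)
Definition angle_eq (x y : R) : Prop := exists k : Z, x = y + 2 * PI * IZR k.

(** The field [v(θ) d/dθ] is given by its 2π-periodic coefficient [v]. *)
Definition C1_field (v : R -> R) : Prop :=
  (forall t, v (t + 2 * PI) = v t) /\
  (forall t, ex_derive v t) /\
  (forall t, continuous (Derive v) t).

Definition commutator (v w : R -> R) : R -> R :=
  fun t => v t * Derive w t - Derive v t * w t.

Definition singular_point (v : R -> R) (t : R) : Prop := v t = 0.

Definition class_C (v : R -> R) : Prop :=
  C1_field v /\
  ~ (exists a b, a < b /\ forall t, a < t < b -> singular_point v t).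

Definition lin_comb (a b c : R) (w v z : R -> R) : R -> R :=
  fun t => a * w t + b * v t + c * z t.

(** The commutation relations make the span of [w], [v], [z] closed under the
    commutator, so it is a Lie algebra. *)
Record realization (w v z : R -> R) : Prop := {
  realization_fields : C1_field w /\ C1_field v /\ C1_field z;
  realization_dim3 : forall a b c,
    (forall t, lin_comb a b c w v z t = 0) -> a = 0 /\ b = 0 /\ c = 0;
  realization_class : forall a b c,
    (exists t, lin_comb a b c w v z t <> 0) -> class_C (lin_comb a b c w v z);
  realization_VW : forall t, commutator v w t = w t;
  realization_ZV : forall t, commutator z v t = z t;
  realization_WZ : forall t, commutator w z t = - 2 * v t
}.

(** A self-map of the circle is given in the angular coordinate by
    [f : R -> R] compatible with [angle_eq]. The values [f x] are arbitrary
    representatives modulo 2π, so [f] itself need not be continuous: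
    continuity and derivatives below are those of the map of the circle. *)
Definition circle_map (f : R -> R) : Prop :=
  forall x y, angle_eq x y -> angle_eq (f x) (f y).

Definition circle_continuous (f : R -> R) (x : R) : Prop :=
  forall eps : posreal,
    locally x (fun y => exists u, angle_eq u (f y) /\ Rabs (u - f x) < eps).

(** [g] is a local branch of the angle [f]; the derivative does not depend
    on its choice. *)
Definition circle_derivative (f : R -> R) (x d : R) : Prop :=
  exists g : R -> R,
    locally x (fun y => angle_eq (g y) (f y)) /\ is_derive g x d.

Definition exceptional (E : list R) (x : R) : Prop :=
  exists e, In e E /\ angle_eq x e.

(** [E] lists the points of discontinuity of the derivative [df] of [f]; the
    values of [df] at these points are irrelevant. *)
Record equivalence_transformation (f df : R -> R) (E : list R) : Prop := {
  et_map : circle_map f;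
  et_one_to_one : forall x y, angle_eq (f x) (f y) -> angle_eq x y;
  et_onto : forall y, exists x, angle_eq (f x) y;
  et_continuous : forall x, circle_continuous f x;
  et_derivative : forall x, ~ exceptional E x -> circle_derivative f x (df x);
  et_derivative_continuous : forall x, ~ exceptional E x -> continuous df x;
  et_infinite : forall x, exceptional E x ->
    filterlim df (locally' x) (Rbar_locally p_infty) \/
    filterlim df (locally' x) (Rbar_locally m_infty)
}.

(** At the images of exceptional points [w'] is determined by continuity, which
    is part of [C1_field w']. *)
Definition transformed (f df : R -> R) (E : list R) (w w' : R -> R) : Prop :=
  C1_field w' /\ forall x, ~ exceptional E x -> w' (f x) = w x * df x.

Definition triple : Type := ((R -> R) * (R -> R) * (R -> R))%type.

Definition transformed_triple (A B : triple) : Prop :=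
  let '(w, v, z) := A in
  let '(w', v', z') := B in
  exists (f df : R -> R) (E : list R),
    equivalence_transformation f df E /\
    transformed f df E w w' /\
    transformed f df E v v' /\
    transformed f df E z z'.

(** Composition of one or more equivalence transformations. *)
Definition equivalent : triple -> triple -> Prop :=
  clos_trans triple transformed_triple.

(** [sigma] takes the values ±1 and is constant on each open interval
    (2πk/n, 2π(k+1)/n); no relation is imposed between the signs on different
    intervals and at their endpoints. *)
Definition sign_function (n : nat) (sigma : R -> R) : Prop :=
  (forall t, sigma t = 1 \/ sigma t = -1) /\
  forall k : nat, (k < n)%nat -> exists sigma_k : R, forall t,
    2 * PI * INR k / INR n < t < 2 * PI * (INR k + 1) / INR n ->
    sigma t = sigma_k.

Definition canonical_form (n : nat) (sigma w v z : R -> R) : Prop :=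
  forall t, 0 <= t < 2 * PI ->
    w t = sigma t * (1 - cos (INR n * t)) /\
    v t = 1 / INR n * sin (INR n * t) /\
    z t = 1 / INR n ^ 2 * sigma t * (1 + cos (INR n * t)).

(* Main.v *)
(** The commutation relations give [v^2 = w z]. On an interval where [v] has no
    zero, [u = v / z] satisfies [u' = 1 / z]; if [w], [v], [z] all vanished at an
    endpoint, then [u] or [1 / u = v / w] would diverge logarithmically there with
    the wrong sign. Hence the three fields have no common zero and [w + z] vanishes
    nowhere. Thus [w / v] is an immersion of the circle into the projective line,
    which carries [w], [v], [z] to [x^2 d/dx], [x d/dx], [d/dx]. It is a covering
    of some degree [n]; in the angle [h] with [tan (h / 2) = w / v], dilating by
    [1 / n] and dividing by [n] gives a diffeomorphism [f] with
    [f' = 2 / (n^2 z + w)] that brings the fields to canonical form with all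
    signs equal to [1], reversing the orientation when [w + z < 0]. *)
Require Import Defs.
From Stdlib Require Import Reals Ranalysis5 ZArith Relations Lra Lia Psatz Classical.
From Coquelicot Require Import Coquelicot.
Open Scope R_scope.

(** * Absence of common zeros of the three fields *)

Lemma is_derive_continuous (f : R -> R) (x l : R) :
  is_derive f x l -> continuous f x.
Proof.
intros H. apply (ex_derive_continuous (K := R_AbsRing) (V := R_NormedModule)).
exists l; exact H.
Qed.

Lemma is_derive_continuity_pt (f : R -> R) (x l : R) :
  is_derive f x l -> continuity_pt f x.
Proof.
intros H. apply continuity_pt_filterlim. exact (is_derive_continuous f x l H).
Qed.

Lemma const_sign (f : R -> R) (a b : R) :
  (forall t, a < t < b -> continuity_pt f t) ->
  (forall t, a < t < b -> f t <> 0) ->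
  (forall t, a < t < b -> 0 < f t) \/ (forall t, a < t < b -> f t < 0).
Proof.
intros Hc Hn.
assert (key : forall x y, a < x < b -> a < y < b -> x < y -> 0 < f x * f y).
{ intros x y Hx Hy Hxy.
  destruct (Rlt_le_dec 0 (f x * f y)) as [|Hle]; [assumption|exfalso].
  pose proof (Hn x Hx) as Hfx; pose proof (Hn y Hy) as Hfy.
  destruct (Rtotal_order (f x) 0) as [Hx0|[Hx0|Hx0]]; [|contradiction|].
  - destruct (IVT_interv f x y) as [c [Hc1 Hc2]]; try nra.
    + intros t Ht; apply Hc; lra.
    + apply (Hn c); [lra|exact Hc2].
  - destruct (IVT_interv (fun t => - f t) x y) as [c [Hc1 Hc2]]; try nra.
    + intros t Ht. apply continuity_pt_opp, Hc; lra.
    + apply (Hn c); lra. }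
assert (key' : forall x y, a < x < b -> a < y < b -> 0 < f x * f y).
{ intros x y Hx Hy. destruct (Rtotal_order x y) as [H|[H|H]].
  - now apply key.
  - subst y. pose proof (Hn x Hx). nra.
  - rewrite Rmult_comm. now apply key. }
destruct (Rlt_le_dec a b) as [Hab|Hab]; [|left; intros; lra].
assert (Hm : a < (a + b) / 2 < b) by lra.
destruct (Rlt_le_dec 0 (f ((a + b) / 2))) as [Hp|Hp].
- left; intros t Ht. pose proof (key' _ _ Hm Ht). nra.
- right; intros t Ht. pose proof (key' _ _ Hm Ht). nra.
Qed.

(* [u = v / z] satisfies [u' = 1 / z], and [z = O(t - a)] makes [u] tend to
   minus infinity at [a]. *)
Lemma no_common_endpoint_pos (v z v1 z1 : R -> R) (a b : R) :
  a < b ->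
  (forall t, is_derive v t (v1 t)) -> (forall t, is_derive z t (z1 t)) ->
  (forall t, z t * v1 t - z1 t * v t = z t) ->
  z a = 0 ->
  (forall t, a < t < b -> 0 < v t) -> (forall t, a < t < b -> 0 < z t) ->
  False.
Proof.
intros Hab Dv Dz ZV za vpos zpos.
assert (Hd := proj1 (is_derive_Reals _ _ _) (Dz a)).
destruct (Hd 1 Rlt_0_1) as [delta Hdelta].
(* Differentiability at [a] with error [1] bounds the difference quotients of [z] by this slope on
   [(a, a + T]]. *)
set (M := Rabs (z1 a) + 1).
assert (M0 : 0 < M) by (unfold M; pose proof (Rabs_pos (z1 a)); lra).
set (T := Rmin delta (b - a) / 2).
assert (T0 : 0 < T < delta /\ a + T < b).
{ unfold T. pose proof (cond_pos delta).
  unfold Rmin; destruct (Rle_dec delta (b - a)); lra. }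
assert (zle : forall t, a < t <= a + T -> z t <= M * (t - a)).
{ intros t Ht. assert (Hh : t - a <> 0) by lra.
  assert (Hb : Rabs (t - a) < delta) by (rewrite Rabs_pos_eq; lra).
  pose proof (Hdelta (t - a) Hh Hb) as H.
  replace (a + (t - a)) with t in H by ring. rewrite za, Rminus_0_r in H.
  apply Rabs_def2 in H. pose proof (Rle_abs (z1 a)).
  assert (Hq : z t / (t - a) <= M) by (unfold M; lra).
  apply Rmult_le_compat_r with (r := t - a) in Hq; [|lra].
  replace (z t / (t - a) * (t - a)) with (z t) in Hq by (field; lra). exact Hq. }
set (u0 := v (a + T) / z (a + T)).
assert (u0pos : 0 < u0) by (apply Rdiv_lt_0_compat; [apply vpos|apply zpos]; lra).
(* Here [/ M * ln ((s - a) / T) = - u0], just enough for [U s <= U (a + T)] to give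
   [v s / z s <= 0]. *)
set (s := a + T * exp (- M * u0)).
assert (Hs : a < s < a + T).
{ assert (0 < exp (- M * u0) < 1).
  { split; [apply exp_pos|]. rewrite <- exp_0. apply exp_increasing. nra. }
  unfold s; nra. }
(* [U] is nondecreasing on [(a, a + T]]: by [zle], [(v / z)' = / z] dominates [/ (M * (t - a))]. *)
set (U := fun t => v t / z t - / M * ln (t - a)).
set (dU := fun t => / z t - / M * / (t - a)).
assert (DU : forall t, a < t < b -> is_derive U t (dU t)).
{ intros t Ht. pose proof (zpos t Ht) as zt.
  assert (D1 : is_derive (fun t => v t / z t) t (/ z t)).
  { evar_last; [apply is_derive_div; [apply Dv|apply Dz|lra]|].
    pose proof (ZV t) as E. replace (v1 t * z t - v t * z1 t) with (z t) by lra.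
    field; lra. }
  assert (D2 : is_derive (fun t => / M * ln (t - a)) t (/ M * / (t - a))).
  { apply (is_derive_scal (fun t => ln (t - a)) t (/ M) (/ (t - a))).
    auto_derive; [lra|field; lra]. }
  exact (is_derive_minus _ _ _ _ _ D1 D2). }
destruct (MVT_gen U s (a + T) dU) as [c [Hc HU]].
- intros x Hx. rewrite Rmin_left, Rmax_right in Hx by lra. apply DU; lra.
- intros x Hx. rewrite Rmin_left, Rmax_right in Hx by lra.
  apply (is_derive_continuity_pt _ _ (dU x)), DU; lra.
- rewrite Rmin_left, Rmax_right in Hc by lra.
  assert (H0 : 0 <= dU c).
  { unfold dU. rewrite <- Rinv_mult.
    assert (/ (M * (c - a)) <= / z c); [|lra].
    apply Rinv_le_contravar; [apply zpos; lra|apply zle; lra]. }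
  unfold U in HU. fold u0 in HU. replace (a + T - a) with T in HU by ring.
  assert (El : ln (s - a) = ln T - M * u0).
  { unfold s. replace (a + T * exp (- M * u0) - a) with (T * exp (- M * u0)) by ring.
    rewrite ln_mult; [rewrite ln_exp; ring|lra|apply exp_pos]. }
  rewrite El in HU.
  assert (us : 0 < v s / z s) by (apply Rdiv_lt_0_compat; [apply vpos|apply zpos]; lra).
  assert (E2 : / M * (ln T - M * u0) = / M * ln T - u0) by (field; lra).
  nra.
Qed.

(** The relation is linear in [z], so a negative [z] is handled by passing to [- z]. *)
Lemma no_common_endpoint (v z v1 z1 : R -> R) (a b : R) :
  a < b ->
  (forall t, is_derive v t (v1 t)) -> (forall t, is_derive z t (z1 t)) ->
  (forall t, z t * v1 t - z1 t * v t = z t) ->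
  z a = 0 ->
  (forall t, a < t < b -> 0 < v t) -> (forall t, a < t < b -> z t <> 0) ->
  False.
Proof.
intros Hab Dv Dz ZV za vpos zn.
destruct (const_sign z a b) as [zpos|zneg]; auto.
- intros t _; exact (is_derive_continuity_pt _ _ _ (Dz t)).
- exact (no_common_endpoint_pos v z v1 z1 a b Hab Dv Dz ZV za vpos zpos).
- apply (no_common_endpoint_pos v (fun t => - z t) v1 (fun t => - z1 t) a b); auto.
  + intros t. apply (is_derive_opp z t (z1 t)), Dz.
  + intros t. pose proof (ZV t). lra.
  + lra.
  + intros t Ht. pose proof (zneg t Ht). lra.
Qed.

Lemma realization_is_derive (w v z : R -> R) : realization w v z ->
  (forall t, is_derive w t (Derive w t)) /\
  (forall t, is_derive v t (Derive v t)) /\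
  (forall t, is_derive z t (Derive z t)).
Proof.
intros [[[_ [Hw _]] [[_ [Hv _]] [_ [Hz _]]]] _ _ _ _ _].
refine (conj _ (conj _ _)); intros t; now apply Derive_correct.
Qed.

(** The sum [v [W,Z] + z [V,W] + w [Z,V]] is a determinant with two equal rows, hence zero; the
    commutation relations turn it into [-2 v^2 + 2 w z]. *)
Lemma realization_casimir (w v z : R -> R) : realization w v z ->
  forall t, v t * v t = w t * z t.
Proof.
intros [_ _ _ VW ZV WZ] t.
specialize (VW t); specialize (ZV t); specialize (WZ t). unfold commutator in *.
set (w1 := Derive w t) in *; set (v1 := Derive v t) in *; set (z1 := Derive z t) in *.
assert (v t * (w t * z1 - w1 * z t) = - 2 * (w t * z t)).
{ replace (v t * (w t * z1 - w1 * z t))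
    with (- z t * (v t * w1 - v1 * w t) - w t * (z t * v1 - z1 * v t)) by ring.
  rewrite VW, ZV. ring. }
rewrite WZ in H. lra.
Qed.

Lemma realization_singular_nowhere_dense (w v z : R -> R) : realization w v z ->
  forall a b, a < b -> exists t, a < t < b /\ v t <> 0.
Proof.
intros [_ dim cls _ _ _] a b Hab.
apply NNPP; intros Hno.
destruct (classic (exists t, lin_comb 0 1 0 w v z t <> 0)) as [He|He].
- destruct (cls _ _ _ He) as [_ Hc]. apply Hc. exists a, b. split; [exact Hab|].
  intros t Ht. unfold singular_point, lin_comb.
  destruct (Req_dec (v t) 0) as [E|E]; [rewrite E; ring|].
  exfalso; apply Hno; now exists t.
- destruct (dim 0 1 0) as [_ [E _]]; [|lra].
  intros t. apply NNPP; intros H. apply He; now exists t.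
Qed.

(* Near a common zero that is a limit of zeros of [v] we have [|v'| < 1], while
   [v' = 1] or [v' = -1] at a zero of [v] which is not a common zero: so all
   nearby zeros of [v] are common ones. *)
Lemma realization_no_common_zero (w v z : R -> R) : realization w v z ->
  forall p, v p = 0 -> w p = 0 -> z p = 0 -> False.
Proof.
intros Hr.
destruct (realization_is_derive w v z Hr) as [Dw [Dv Dz]].
pose proof (realization_casimir w v z Hr) as Cas.
pose proof (realization_singular_nowhere_dense w v z Hr) as Dense.
assert (Cv : forall t, continuous (Derive v) t).
{ destruct Hr as [[_ [[_ [_ H]] _]] _ _ _ _ _]. exact H. }
destruct Hr as [_ _ _ VW ZV _]. unfold commutator in VW, ZV.
assert (endpoint : forall a b, a < b -> w a = 0 -> z a = 0 ->
  (forall t, a < t < b -> v t <> 0) -> False).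
{ intros a b Hab wa za vn.
  assert (wzn : forall t, a < t < b -> w t <> 0 /\ z t <> 0).
  { intros t Ht. pose proof (vn t Ht). pose proof (Cas t). split; intros E; nra. }
  destruct (const_sign v a b) as [vpos|vneg]; auto.
  - intros t _; exact (is_derive_continuity_pt _ _ _ (Dv t)).
  - apply (no_common_endpoint v z (Derive v) (Derive z) a b); auto.
    intros t Ht; apply (wzn t Ht).
  (* For [v < 0] the pair [- v], [w] takes the place of [v], [z]: [[V,W] = W] reads
     [w (- v)' - w' (- v) = w]. *)
  - apply (no_common_endpoint (fun t => - v t) w (fun t => - Derive v t) (Derive w) a b);
      auto.
    + intros t. apply (is_derive_opp v t (Derive v t)), Dv.
    + intros t. pose proof (VW t). lra.
    + intros t Ht. pose proof (vneg t Ht). lra.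
    + intros t Ht; apply (wzn t Ht). }
intros p vp wp zp.
destruct (proj1 (filterlim_locally _ _) (Cv p) (mkposreal (1 / 2) ltac:(lra)))
  as [delta Hdelta].
assert (Hd : forall t, p <= t < p + delta ->
  Rabs (Derive v t - Derive v p) < 1 / 2).
{ intros t Ht. apply Hdelta. change (Rabs (t - p) < delta).
  rewrite Rabs_pos_eq; lra. }
pose proof (cond_pos delta) as dpos.
destruct (classic (exists q, p < q < p + delta /\ v q = 0)) as [[q [Hq vq]]|Hno].
2: { apply (endpoint p (p + delta)); auto; [lra|].
     intros t Ht E; apply Hno; now exists t. }
(* By Rolle [v'] vanishes between the zeros [p] and [q], and it stays within [1/2] of [v' p] on the
   whole interval. *)
assert (vsmall : forall t, p <= t < p + delta -> -1 < Derive v t < 1).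
{ destruct (MVT_gen v p q (Derive v)) as [c [Hc Ec]].
  - intros x _; apply Dv.
  - intros x _; exact (is_derive_continuity_pt _ _ _ (Dv x)).
  - rewrite Rmin_left, Rmax_right in Hc by lra.
    assert (E0 : Derive v c = 0) by (rewrite vp, vq in Ec; nra).
    assert (H1 := Hd c ltac:(lra)). rewrite E0 in H1.
    intros t Ht. assert (H2 := Hd t Ht).
    apply Rabs_def2 in H1; apply Rabs_def2 in H2. lra. }
destruct (Dense p q) as [t0 [Ht0 vt0]]; [lra|].
(* [a] is the last zero of [v] before [t0], so [v] has no zero on [(a, t0)]. *)
destruct (completeness (fun t => t <= t0 /\ v t = 0)) as [a [aub alub]].
{ exists t0. intros t [Ht _]; exact Ht. }
{ exists p. split; [lra|exact vp]. }
assert (pa : p <= a) by (apply aub; split; [lra|exact vp]).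
assert (at0 : a <= t0) by (apply alub; intros t [Ht _]; exact Ht).
assert (va : v a = 0).
{ apply NNPP; intros Hn.
  assert (Hl : locally a (fun t => v t <> 0)).
  { apply (is_derive_continuous _ _ _ (Dv a) (fun y => y <> 0)).
    apply (open_neq 0 (v a) Hn). }
  destruct Hl as [e He]. pose proof (cond_pos e).
  assert (a <= a - e / 2); [|lra].
  apply alub. intros t [Ht E]. apply Rnot_lt_le; intros Hlt.
  assert (t <= a) by (apply aub; now split).
  apply (He t); [|exact E]. change (Rabs (t - a) < e).
  rewrite Rabs_left1; lra. }
assert (a < t0).
{ destruct at0 as [|E]; [assumption|]. subst t0; contradiction. }
pose proof (vsmall a ltac:(lra)) as Hs.
apply (endpoint a t0); auto.
(* At [a] the relations reduce to [w (1 + v') = 0] and [z (1 - v') = 0], and [|v'| < 1] makes [a] a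
   common zero. *)
- pose proof (VW a) as E. rewrite va in E. nra.
- pose proof (ZV a) as E. rewrite va in E. nra.
- intros t Ht E. assert (t <= a); [|lra]. apply aub. split; [lra|exact E].
Qed.

(** If [z = - w] at a point, then [v^2 = - w^2] there and all three fields vanish. *)
Lemma realization_sum_neq0 (w v z : R -> R) : realization w v z ->
  forall t, w t + z t <> 0.
Proof.
intros Hr t E.
pose proof (realization_casimir w v z Hr t) as Cas.
apply (realization_no_common_zero w v z Hr t); nra.
Qed.

(** * Angles and their continuous lifts *)

Lemma is_derive_0_const (f : R -> R) :
  (forall t, is_derive f t 0) -> forall x y, f x = f y.
Proof.
intros Df x y.
destruct (MVT_gen f y x (fun _ => 0)) as [c [_ E]].
- intros t _; apply Df.
- intros t _; exact (is_derive_continuity_pt _ _ _ (Df t)).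
- lra.
Qed.

Lemma shift_iter (f : R -> R) (T c : R) :
  (forall t, f (t + T) = f t + c) ->
  forall (k : Z) t, f (t + T * IZR k) = f t + c * IZR k.
Proof.
intros Hf k. induction k as [|k IH|k IH] using Z.peano_ind; intros t.
- rewrite !Rmult_0_r, !Rplus_0_r; reflexivity.
- rewrite succ_IZR.
  replace (t + T * (IZR k + 1)) with (t + T * IZR k + T) by ring.
  rewrite Hf, IH; ring.
- rewrite <- Z.sub_1_r, minus_IZR.
  pose proof (Hf (t + T * (IZR k - 1))) as E.
  replace (t + T * (IZR k - 1) + T) with (t + T * IZR k) in E by ring.
  rewrite IH in E. lra.
Qed.

Lemma cos_shift_Z (t : R) (k : Z) : cos (t + 2 * PI * IZR k) = cos t.
Proof.
rewrite (shift_iter cos (2 * PI) 0); [ring|].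
intros x. rewrite cos_plus, cos_2PI, sin_2PI. ring.
Qed.

Lemma sin_shift_Z (t : R) (k : Z) : sin (t + 2 * PI * IZR k) = sin t.
Proof.
rewrite (shift_iter sin (2 * PI) 0); [ring|].
intros x. rewrite sin_plus, cos_2PI, sin_2PI. ring.
Qed.

Lemma cos_sin_eq_angle (a b : R) :
  cos a = cos b -> sin a = sin b -> angle_eq a b.
Proof.
intros Ec Es.
assert (E1 : cos (a - b) = 1).
{ rewrite cos_minus, Ec, Es. pose proof (sin2_cos2 b). unfold Rsqr in *. lra. }
assert (E2 : sin ((a - b) / 2) = 0).
{ replace (a - b) with (2 * ((a - b) / 2)) in E1 by field.
  rewrite cos_2a_sin in E1. nra. }
destruct (sin_eq_0_0 _ E2) as [k Hk].
exists k. lra.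
Qed.

Lemma angle_of_unit_vector (c s : R) :
  c * c + s * s = 1 -> exists h, cos h = c /\ sin h = s.
Proof.
intros E.
assert (Hc : -1 <= c <= 1) by nra.
assert (E2 : sin (acos c) * sin (acos c) = s * s).
{ pose proof (sin2_cos2 (acos c)) as H. rewrite cos_acos in H by exact Hc.
  unfold Rsqr in H. lra. }
assert (E3 : (sin (acos c) - s) * (sin (acos c) + s) = 0) by (ring_simplify; lra).
destruct (Rmult_integral _ _ E3).
- exists (acos c). split; [now apply cos_acos|lra].
- exists (- acos c). rewrite cos_neg, sin_neg. split; [now apply cos_acos|lra].
Qed.

(** The lift is the integral of the angular speed [g]. Both [(c, s)] and [(cos h, sin h)] rotate
    with this speed, so their squared distance [d] is constant, and it is zero at [0]. *)
Lemma angle_lift (c s g : R -> R) :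
  (forall t, continuous g t) ->
  (forall t, is_derive c t (- g t * s t)) ->
  (forall t, is_derive s t (g t * c t)) ->
  c 0 * c 0 + s 0 * s 0 = 1 ->
  exists h, forall t, is_derive h t (g t) /\ cos (h t) = c t /\ sin (h t) = s t.
Proof.
intros Cg Dc Ds E0.
destruct (angle_of_unit_vector _ _ E0) as [h0 [Hc Hs]].
set (h := fun t => h0 + RInt g 0 t).
assert (Dh : forall t, is_derive h t (g t)).
{ intros t. unfold h. evar_last.
  - apply @is_derive_plus; [apply is_derive_const|].
    apply (is_derive_RInt g (fun t => RInt g 0 t) 0 t); [|apply Cg].
    apply filter_forall. intros x. apply (RInt_correct (V := R_CompleteNormedModule)).
    apply (ex_RInt_continuous (V := R_CompleteNormedModule)). intros; apply Cg.
  - apply plus_zero_l. }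
assert (h00 : h 0 = h0) by (unfold h; rewrite RInt_point; apply Rplus_0_r).
set (d := fun t => (c t - cos (h t)) ^ 2 + (s t - sin (h t)) ^ 2).
assert (Dd : forall t, is_derive d t 0).
{ intros t. unfold d.
  assert (Exc : ex_derive (fun x => c x) t) by (eexists; apply Dc).
  assert (Exs : ex_derive (fun x => s x) t) by (eexists; apply Ds).
  assert (Exh : ex_derive (fun x => h x) t) by (eexists; apply Dh).
  auto_derive; [tauto|].
  replace (Derive (fun x => c x) t) with (- g t * s t)
    by (symmetry; apply is_derive_unique, Dc).
  replace (Derive (fun x => s x) t) with (g t * c t)
    by (symmetry; apply is_derive_unique, Ds).
  replace (Derive (fun x => h x) t) with (g t)
    by (symmetry; apply is_derive_unique, Dh).
  ring. }
exists h. intros t.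
assert (Ed : d t = 0).
{ rewrite (is_derive_0_const d Dd t 0). unfold d. rewrite h00, Hc, Hs. ring. }
unfold d in Ed.
pose proof (pow2_ge_0 (c t - cos (h t))). pose proof (pow2_ge_0 (s t - sin (h t))).
split; [apply Dh|]. split; symmetry; apply Rminus_diag_uniq, Rsqr_0_uniq;
  rewrite Rsqr_pow2; lra.
Qed.

(** With [x = w / v = tan (h / 2)] and [v^2 = w z], the fractions are [(1 - x^2) / (1 + x^2)] and
    [2 x / (1 + x^2)], in a form that is also defined at the zeros of [v]. The numerators of their
    derivatives are combinations of commutators. *)
Lemma realization_angle (w v z : R -> R) : realization w v z ->
  exists h, forall t,
    is_derive h t (2 / (w t + z t)) /\
    cos (h t) = (z t - w t) / (w t + z t) /\
    sin (h t) = 2 * v t / (w t + z t).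
Proof.
intros Hr.
destruct (realization_is_derive w v z Hr) as [Dw [Dv Dz]].
pose proof (realization_casimir w v z Hr) as Cas.
pose proof (realization_sum_neq0 w v z Hr) as Sn.
destruct Hr as [_ _ _ VW ZV WZ]. unfold commutator in *.
assert (Dr : forall t, is_derive (fun t => w t + z t) t (Derive w t + Derive z t)).
{ intros t. exact (is_derive_plus w z t _ _ (Dw t) (Dz t)). }
apply (angle_lift (fun t => (z t - w t) / (w t + z t))
  (fun t => 2 * v t / (w t + z t)) (fun t => 2 / (w t + z t))).
- intros t.
  apply (is_derive_continuous _ _ _ (is_derive_div (fun _ => 2) _ t 0 _
    (is_derive_const 2 t) (Dr t) (Sn t))).
- intros t. evar_last.
  + apply is_derive_div; [exact (is_derive_minus z w t _ _ (Dz t) (Dw t))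
                         |apply Dr|apply Sn].
  + unfold minus, plus, opp; simpl.
    specialize (WZ t). pose proof (Sn t).
    replace ((Derive z t + - Derive w t) * (w t + z t)
             - (z t - w t) * (Derive w t + Derive z t))
      with (2 * (w t * Derive z t - Derive w t * z t)) by ring.
    rewrite WZ. field; assumption.
- intros t. evar_last.
  + apply is_derive_div; [exact (is_derive_scal v t 2 _ (Dv t))
                         |apply Dr|apply Sn].
  + simpl. pose proof (Sn t).
    replace (2 * Derive v t * (w t + z t) - 2 * v t * (Derive w t + Derive z t))
      with (2 * ((z t * Derive v t - Derive z t * v t)
                 - (v t * Derive w t - Derive v t * w t))) by ring.
    rewrite ZV, VW. field; assumption.
- pose proof (Sn 0). pose proof (Cas 0) as Cas0.
  apply Rmult_eq_reg_r with ((w 0 + z 0) * (w 0 + z 0));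
    [|now apply Rmult_integral_contrapositive].
  replace (((z 0 - w 0) / (w 0 + z 0) * ((z 0 - w 0) / (w 0 + z 0)) +
    2 * v 0 / (w 0 + z 0) * (2 * v 0 / (w 0 + z 0))) * ((w 0 + z 0) * (w 0 + z 0)))
    with ((z 0 - w 0) * (z 0 - w 0) + 4 * (v 0 * v 0)) by (field; assumption).
  rewrite Cas0. ring.
Qed.

(** * Dilations of the projective line in the angular coordinate *)

(* The lift to angles of the dilation [x |-> x / m] of the projective line, in
   the coordinate [x = tan (h / 2)]. *)
Definition dilation (m h : R) : R :=
  h + 2 * atan ((1 - m) * sin h / ((m + 1) + (m - 1) * cos h)).

Lemma dilation_shift (m h : R) (k : Z) :
  dilation m (h + 2 * PI * IZR k) = dilation m h + 2 * PI * IZR k.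
Proof. unfold dilation. rewrite cos_shift_Z, sin_shift_Z. ring. Qed.

Lemma cos_double_atan (y : R) : cos (2 * atan y) = (1 - y * y) / (1 + y * y).
Proof.
assert (H : 0 < 1 + y * y) by nra.
rewrite cos_2a_cos, cos_atan. unfold Rsqr.
replace (2 * (1 / sqrt (1 + y * y)) * (1 / sqrt (1 + y * y)))
  with (2 / (sqrt (1 + y * y) * sqrt (1 + y * y)))
  by (field; apply Rgt_not_eq, sqrt_lt_R0, H).
rewrite sqrt_sqrt by lra. field. lra.
Qed.

Lemma sin_double_atan (y : R) : sin (2 * atan y) = 2 * y / (1 + y * y).
Proof.
assert (H : 0 < 1 + y * y) by nra.
rewrite sin_2a, cos_atan, sin_atan. unfold Rsqr.
replace (2 * (y / sqrt (1 + y * y)) * (1 / sqrt (1 + y * y)))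
  with (2 * y / (sqrt (1 + y * y) * sqrt (1 + y * y)))
  by (field; apply Rgt_not_eq, sqrt_lt_R0, H).
rewrite sqrt_sqrt by lra. reflexivity.
Qed.

Lemma dilation_spec (m h : R) : 0 < m ->
  let q := m * m * (1 + cos h) + (1 - cos h) in
  is_derive (dilation m) h (2 * m / q) /\
  cos (dilation m h) = (m * m * (1 + cos h) - (1 - cos h)) / q /\
  sin (dilation m h) = 2 * m * sin h / q.
Proof.
intros Hm q.
pose proof (COS_bound h) as Hb.
assert (Es : sin h * sin h = 1 - cos h * cos h).
{ pose proof (sin2_cos2 h). unfold Rsqr in *. lra. }
(* The case [k = m * m] is [q], and [k = m] is the denominator [B] below. *)
assert (pos : forall k, 0 < k -> 0 < k * (1 + cos h) + (1 - cos h)).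
{ intros k Hk. destruct (Rle_lt_dec (cos h) 0); nra. }
assert (q0 : 0 < q) by (apply pos; nra).
set (A := (1 - m) * sin h). set (B := (m + 1) + (m - 1) * cos h).
assert (B0 : 0 < B) by (unfold B; pose proof (pos m Hm); lra).
assert (EA : A * A = (1 - m) * (1 - m) * (1 - cos h * cos h)).
{ unfold A. rewrite <- Es. ring. }
assert (EAB : A * A + B * B = 2 * q) by (rewrite EA; unfold B, q; ring).
assert (Ey : 1 + A / B * (A / B) = 2 * q / (B * B)).
{ rewrite <- EAB. field. lra. }
assert (Ec : cos (2 * atan (A / B)) = (B * B - A * A) / (2 * q)).
{ rewrite cos_double_atan, Ey. field. lra. }
assert (Esn : sin (2 * atan (A / B)) = A * B / q).
{ rewrite sin_double_atan, Ey. field. lra. }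
assert (EsA : sin h * A = (1 - m) * (1 - cos h * cos h)).
{ unfold A. rewrite <- Es. ring. }
split; [|split].
- unfold dilation. auto_derive; [fold B; lra|].
  fold A B. unfold Rsqr. simpl.
  replace (1 + A * / B * (A * / B * 1)) with (2 * q / (B * B))
    by (rewrite <- Ey; field; lra).
  transitivity ((q + ((1 - m) * cos h * B + (m - 1) * (sin h * A))) / q).
  { field. lra. }
  rewrite EsA. apply f_equal2; [|reflexivity]. unfold q, B. ring.
- unfold dilation. fold A B. rewrite cos_plus, Ec, Esn.
  transitivity ((cos h * (B * B - A * A) - 2 * (sin h * A) * B) / 2 / q).
  { field. lra. }
  rewrite EsA, EA. apply f_equal2; [|reflexivity]. unfold B. field.
- unfold dilation. fold A B. rewrite sin_plus, Ec, Esn.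
  transitivity ((sin h * (B * B - A * A) + 2 * cos h * A * B) / 2 / q).
  { field. lra. }
  rewrite EA. apply f_equal2; [|reflexivity]. unfold A, B. field.
Qed.

(** * Diffeomorphisms of the circle and periodic fields *)

Lemma angle_eq_refl (x : R) : angle_eq x x.
Proof. exists 0%Z. ring. Qed.

(** The number [e], equal to [1] or [-1], is the degree. Strict monotonicity makes the lift
    injective, and over one period it sweeps an interval of length exactly [2 * PI]. *)
Lemma circle_diffeomorphism (f df : R -> R) (e : Z) :
  (e * e)%Z = 1%Z ->
  (forall t, is_derive f t (df t)) ->
  (forall t, continuous df t) ->
  (forall t, 0 < IZR e * df t) ->
  (forall t, f (t + 2 * PI) = f t + 2 * PI * IZR e) ->
  equivalence_transformation f df nil.
Proof.
intros ee Df Cdf pos shift.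
assert (ee' : IZR e * IZR e = 1) by (rewrite <- mult_IZR, ee; reflexivity).
pose proof PI_RGT_0 as PI0.
assert (shift_k : forall k t,
  f (t + 2 * PI * IZR k) = f t + 2 * PI * IZR (e * k)).
{ intros k t. rewrite (shift_iter f _ _ shift), mult_IZR. ring. }
assert (inj : forall x y, f x = f y -> x = y).
{ intros x y E.
  destruct (MVT_gen f y x df) as [c [_ Ec]].
  - intros t _; apply Df.
  - intros t _; exact (is_derive_continuity_pt _ _ _ (Df t)).
  - pose proof (pos c).
    assert (Hp : df c * (x - y) = 0) by lra.
    destruct (Rmult_integral _ _ Hp) as [E0|E0]; [rewrite E0 in *; lra|lra]. }
constructor.
- intros x y [k Hk]. exists (e * k)%Z. rewrite Hk. apply shift_k.
- intros x y [k Hk]. exists (e * k)%Z. apply inj.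
  rewrite shift_k, Hk, Z.mul_assoc, ee, Z.mul_1_l. reflexivity.
- intros y.
  set (q := (IZR e * y - IZR e * f 0) / (2 * PI)).
  (* [q] counts the turns from [f 0] to [y], in the direction of [e]. Its integer part is
     [up q - 1], and removing [k] turns brings the target into the range of [IZR e * f] on
     [[0, 2 * PI]]. *)
  destruct (archimed q) as [Hk1 Hk2]. set (k := (up q - 1)%Z).
  assert (Hk : IZR k <= q < IZR k + 1) by (unfold k; rewrite minus_IZR; lra).
  assert (Eq : IZR e * y = IZR e * f 0 + 2 * PI * q) by (unfold q; field; lra).
  pose proof (shift 0) as E2. rewrite Rplus_0_l in E2.
  assert (E2' : IZR e * f (2 * PI) = IZR e * f 0 + 2 * PI).
  { rewrite E2. transitivity (IZR e * f 0 + 2 * PI * (IZR e * IZR e)); [ring|].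
    rewrite ee'. ring. }
  destruct (f_interv_is_interv (fun t => IZR e * f t) 0 (2 * PI)
    (IZR e * y - 2 * PI * IZR k)) as [x [_ Hx]].
  + lra.
  + rewrite E2', Eq. nra.
  + intros t _. apply continuity_pt_scal, (is_derive_continuity_pt _ _ _ (Df t)).
  + exists x, (- (e * k))%Z. rewrite opp_IZR, mult_IZR.
    apply Rmult_eq_reg_l with (IZR e); [rewrite Hx|intros E0; rewrite E0 in ee'; lra].
    transitivity (IZR e * y - 2 * PI * IZR k * (IZR e * IZR e)); [|ring].
    rewrite ee'. ring.
- intros x eps.
  apply (filter_imp (fun y => ball (f x) eps (f y))).
  + intros y Hy. exists (f y). split; [apply angle_eq_refl|exact Hy].
  + exact (proj1 (filterlim_locally _ _) (is_derive_continuous _ _ _ (Df x)) eps).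
- intros x _. exists f. split; [apply filter_forall; intros; apply angle_eq_refl|apply Df].
- intros x _. apply Cdf.
- intros x [e0 [[] _]].
Qed.

Lemma C1_field_intro (f df : R -> R) :
  (forall t, f (t + 2 * PI) = f t) ->
  (forall t, is_derive f t (df t)) ->
  (forall t, continuous df t) -> C1_field f.
Proof.
intros per Df Cdf. split; [exact per|split].
- intros t. exists (df t). apply Df.
- intros t. apply (continuous_ext df); [|apply Cdf].
  intros x. symmetry. apply is_derive_unique, Df.
Qed.

(** All three canonical fields have this shape when the signs are [1]. *)
Lemma C1_field_trig (n : nat) (a b c : R) :
  C1_field (fun t => a + b * cos (INR n * t) + c * sin (INR n * t)).
Proof.
apply (C1_field_intro _
  (fun t => INR n * (c * cos (INR n * t) - b * sin (INR n * t)))).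
- intros t.
  replace (INR n * (t + 2 * PI)) with (INR n * t + 2 * PI * IZR (Z.of_nat n))
    by (rewrite <- INR_IZR_INZ; ring).
  rewrite cos_shift_Z, sin_shift_Z. reflexivity.
- intros t. auto_derive; [exact I|ring].
- intros t. apply (ex_derive_continuous (K := R_AbsRing) (V := R_NormedModule)).
  auto_derive. exact I.
Qed.

(** * Orientation and reduction to canonical form *)

(** Since [w z = v^2 >= 0], neither [w] nor [z] can have the sign opposite to that of [w + z], which
    is constant by continuity; [e] is that sign. *)
Lemma realization_orientation (w v z : R -> R) : realization w v z ->
  exists e : Z, (e * e)%Z = 1%Z /\
    forall t, 0 <= IZR e * w t /\ 0 <= IZR e * z t /\ 0 < IZR e * (w t + z t).
Proof.
intros Hr.
destruct (realization_is_derive w v z Hr) as [Dw [_ Dz]].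
pose proof (realization_casimir w v z Hr) as Cas.
pose proof (realization_sum_neq0 w v z Hr) as Sn.
assert (one_sign : forall t, 0 < (w 0 + z 0) * (w t + z t)).
{ intros t. pose proof (Rle_abs t). pose proof (Rle_abs (- t)) as Hm.
  rewrite Rabs_Ropp in Hm. pose proof (Rabs_pos t).
  destruct (const_sign (fun t => w t + z t) (- Rabs t - 1) (Rabs t + 1)) as [H2|H2].
  - intros x _. exact (is_derive_continuity_pt _ _ _
      (is_derive_plus w z x _ _ (Dw x) (Dz x))).
  - intros x _. apply Sn.
  - pose proof (H2 0 ltac:(lra)). pose proof (H2 t ltac:(lra)). nra.
  - pose proof (H2 0 ltac:(lra)). pose proof (H2 t ltac:(lra)). nra. }
destruct (Rlt_le_dec 0 (w 0 + z 0)) as [H0|H0].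
- exists 1%Z. split; [reflexivity|]. intros t.
  assert (0 < w t + z t) by (pose proof (one_sign t); nra).
  pose proof (Cas t). repeat split; nra.
- exists (-1)%Z. split; [reflexivity|]. intros t.
  assert (w t + z t < 0) by (pose proof (one_sign t); nra).
  pose proof (Cas t). repeat split; nra.
Qed.

Theorem theorem3 :
  forall w v z : R -> R, realization w v z ->
  exists (n : nat) (sigma w' v' z' : R -> R),
    (1 <= n)%nat /\
    sign_function n sigma /\
    canonical_form n sigma w' v' z' /\
    equivalent (w, v, z) (w', v', z').
Proof.
intros w v z Hr.
destruct (realization_angle w v z Hr) as [h Hh].
destruct (realization_orientation w v z Hr) as [e [ee He]].
destruct (realization_is_derive w v z Hr) as [Dw [_ Dz]].
pose proof (realization_sum_neq0 w v z Hr) as Sn.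
assert (per : forall t, w (t + 2 * PI) = w t /\ v (t + 2 * PI) = v t /\
  z (t + 2 * PI) = z t).
{ destruct Hr as [[[H1 _] [[H2 _] [H3 _]]] _ _ _ _ _]. auto. }
pose proof PI_RGT_0 as PI0.
assert (ee' : IZR e * IZR e = 1) by (rewrite <- mult_IZR, ee; reflexivity).
assert (Dh : forall t, is_derive h t (2 / (w t + z t))) by (intros; apply Hh).
assert (speed : forall t, 0 < IZR e * (2 / (w t + z t))).
{ intros t. replace (IZR e * (2 / (w t + z t))) with (2 / (IZR e * (w t + z t))).
  - apply Rdiv_lt_0_compat; [lra|apply He].
  - pose proof (Sn t). assert (IZR e <> 0) by (intros E; rewrite E in ee'; lra).
    transitivity (2 * (IZR e * IZR e) / (IZR e * (w t + z t))); [|field; auto].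
    rewrite ee'. field; auto. }
(* [N] is the signed winding number of [h] over one period. *)
destruct (cos_sin_eq_angle (h (2 * PI)) (h 0)) as [N HN].
{ destruct (Hh (2 * PI)) as [_ [-> _]]. destruct (Hh 0) as [_ [-> _]].
  destruct (per 0) as [E1 [_ E3]]. rewrite Rplus_0_l in E1, E3. now rewrite E1, E3. }
{ destruct (Hh (2 * PI)) as [_ [_ ->]]. destruct (Hh 0) as [_ [_ ->]].
  destruct (per 0) as [E1 [E2 E3]]. rewrite Rplus_0_l in E1, E2, E3.
  now rewrite E1, E2, E3. }
assert (shift : forall t, h (t + 2 * PI) = h t + 2 * PI * IZR N).
{ intros t. assert (Ed : h (t + 2 * PI) - h t = h (0 + 2 * PI) - h 0).
  { apply (is_derive_0_const (fun t => h (t + 2 * PI) - h t)).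
    intros x. assert (D1 : is_derive (fun t => h (t + 2 * PI)) x (2 / (w x + z x))).
    { destruct (per x) as [E1 [_ E3]]. rewrite <- E1, <- E3.
      evar_last; [apply (is_derive_comp h (fun t => t + 2 * PI)); [apply Dh|]|].
      - auto_derive; [exact I|reflexivity].
      - apply Rmult_1_l. }
    evar_last; [exact (is_derive_minus _ _ _ _ _ D1 (Dh x))|].
    apply Rminus_diag. }
  rewrite Rplus_0_l in Ed. lra. }
(* By the mean value theorem [N] is a value of [h'], so it has the sign [e] and is nonzero. *)
assert (eN : 0 < IZR e * IZR N).
{ destruct (MVT_gen h 0 (2 * PI) (fun t => 2 / (w t + z t))) as [c [_ Ec]].
  - intros t _; apply Dh.
  - intros t _; exact (is_derive_continuity_pt _ _ _ (Dh t)).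
  - rewrite HN in Ec.
    replace (IZR N) with (2 / (w c + z c)); [apply speed|].
    apply Rmult_eq_reg_l with (2 * PI); lra. }
set (n := Z.to_nat (e * N)).
assert (n1 : (0 < e * N)%Z) by (apply lt_IZR; rewrite mult_IZR; exact eN).
assert (En : INR n = IZR e * IZR N).
{ unfold n. rewrite INR_IZR_INZ, Z2Nat.id, mult_IZR by lia. reflexivity. }
assert (n0 : 0 < INR n) by lra.
(* This is the denominator of [f']; it has the sign [e] everywhere because [w] and [z] never have
   opposite signs or vanish together. *)
set (r := fun t => INR n * INR n * z t + w t).
assert (er : forall t, 0 < IZR e * r t).
{ intros t. unfold r. destruct (He t) as [H1 [H2 H3]].
  assert (H4 : 0 < INR n * INR n) by now apply Rmult_lt_0_compat.
  replace (IZR e * (INR n * INR n * z t + w t))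
    with (INR n * INR n * (IZR e * z t) + IZR e * w t) by ring.
  destruct (Rle_lt_dec (IZR e * z t) 0) as [Hz|Hz].
  - replace (IZR e * z t) with 0 by lra. lra.
  - pose proof (Rmult_lt_0_compat _ _ H4 Hz). lra. }
assert (r0 : forall t, r t <> 0).
{ intros t E. pose proof (er t) as H. rewrite E in H. lra. }
(* Division by [n] reduces the degree from [N] to [e]. Alone it would leave a factor [1 / n] on each
   field; the dilation changes these factors to [1], [1 / n], [1 / n^2] for [w], [v], [z]. *)
set (f := fun t => dilation (INR n) (h t) / INR n).
set (df := fun t => 2 / r t).
assert (Eq : forall t, INR n * INR n * (1 + cos (h t)) + (1 - cos (h t))
  = 2 * r t / (w t + z t)).
{ intros t. destruct (Hh t) as [_ [-> _]]. unfold r. field. apply Sn. }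
assert (Df : forall t, is_derive f t (df t)).
{ intros t. destruct (dilation_spec (INR n) (h t) n0) as [D _].
  cbv zeta in D. rewrite Eq in D.
  assert (D2 := is_derive_scal _ _ (/ INR n) _ (is_derive_comp _ _ _ _ _ D (Dh t))).
  apply (is_derive_ext (fun t => / INR n * dilation (INR n) (h t))).
  - intros x. apply Rmult_comm.
  - evar_last; [exact D2|].
    change (/ INR n * (2 / (w t + z t) * (2 * INR n / (2 * r t / (w t + z t))))
      = 2 / r t).
    pose proof (Sn t). pose proof (r0 t). field. repeat split; auto; lra. }
assert (Cf : forall t, cos (INR n * f t) = (INR n * INR n * z t - w t) / r t /\
  sin (INR n * f t) = 2 * INR n * v t / r t).
{ intros t. destruct (dilation_spec (INR n) (h t) n0) as [_ [H1 H2]].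
  cbv zeta in H1, H2. rewrite Eq in H1, H2.
  replace (INR n * f t) with (dilation (INR n) (h t)) by (unfold f; field; lra).
  rewrite H1, H2. destruct (Hh t) as [_ [-> ->]].
  pose proof (Sn t). pose proof (r0 t). split; field; auto. }
assert (equiv : equivalence_transformation f df nil).
{ apply (circle_diffeomorphism f df e ee Df).
  - intros t. apply (is_derive_continuous _ _ (- (2 * (INR n * INR n * Derive z t
      + Derive w t)) / (r t * r t))).
    assert (Exw : ex_derive (fun x => w x) t) by (eexists; apply Dw).
    assert (Exz : ex_derive (fun x => z x) t) by (eexists; apply Dz).
    unfold df, r. auto_derive; [repeat split; auto; apply (r0 t)|].
    pose proof (r0 t) as H. unfold r in H.
    change (fun x => w x) with w. change (fun x => z x) with z. field. exact H.
  - intros t. unfold df. replace (IZR e * (2 / r t)) with (2 * (IZR e * r t) / (r t * r t))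
      by (field; apply r0).
    pose proof (er t). pose proof (r0 t). apply Rdiv_lt_0_compat; [lra|].
    apply Rsqr_pos_lt; assumption.
  - intros t. unfold f. rewrite shift, dilation_shift.
    replace (IZR N) with (INR n * IZR e).
    + field. lra.
    + rewrite En. transitivity (IZR e * IZR e * IZR N); [ring|]. rewrite ee'. ring. }
(* When [e = -1] the decreasing [f] absorbs the sign, so the constant [1] serves in both cases. The
   padded coefficients match [C1_field_trig]. *)
exists n, (fun _ => 1),
  (fun t => 1 + -1 * cos (INR n * t) + 0 * sin (INR n * t)),
  (fun t => 0 + 0 * cos (INR n * t) + 1 / INR n * sin (INR n * t)),
  (fun t => 1 / INR n ^ 2 + 1 / INR n ^ 2 * cos (INR n * t) + 0 * sin (INR n * t)).
split; [unfold n; lia|]. split; [|split].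
- split; [now left|]. intros k _. now exists 1.
- intros t _. split; [|split]; ring.
- apply t_step. exists f, df, nil. split; [exact equiv|].
  split; [|split]; (split; [apply C1_field_trig|]); intros t _;
    destruct (Cf t) as [-> ->]; unfold df; pose proof (r0 t) as H.
  (* By [Cf], [1 - cos (n f) = 2 w / r], which is [w * df]; the other two fields are checked
     likewise. *)
  + unfold r in *. field. exact H.
  + field. split; (exact H || lra).
  + unfold r in *. field. split; (exact H || lra).
Qed.
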